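(* Let $(T_n)_{n\ge 0}$ be the Tribonacci sequence. The Diophantine equation $$(T_{n}-1)\cdots (T_{n+k-1}-1)\,(T_{n+k}+1) \cdots (T_{n+k+\ell-1}+1)=d\left(\frac{10^{m}-1}{9}\right)$$ has no solution in positive integers $n,k,\ell,m,d$ with $1\leq d\leq 9$ and $m\geq 2$.
   Context: The Tribonacci sequence is defined by $T_0=0$, $T_1=T_2=1$ and $T_{n+3}=T_{n+2}+T_{n+1}+T_n$ for all $n\ge 0$. The right-hand side $d(10^m-1)/9$ is the repdigit consisting of $m$ copies of the digit $d$. *)

(* Defs.v *)
From mathcomp Require Import all_boot all_order all_algebra.

Set Implicit Arguments.
Unset Strict Implicit.
Unset Printing Implicit Defensive.

Fixpoint tribonacci (n : nat) : nat :=
  match n with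
  | 0 => 0
  | 1 => 1
  | 2 => 1
  | ((p.+1 as q).+1 as r).+1 => tribonacci r + tribonacci q + tribonacci p
  end.

(* Main.v *)
Require Import Defs.
From mathcomp Require Import all_boot all_order all_algebra.
From mathcomp Require Import zify.

Set Implicit Arguments.
Unset Strict Implicit.
Unset Printing Implicit Defensive.

(** A repdigit [d * 11...1] with [m >= 2] digits is not divisible by 16, whereas
    two of any four consecutive Tribonacci numbers are odd, so that eight or
    more factors [T_i - 1], [T_i + 1] have a product divisible by 16.  This
    leaves finitely many pairs [(k, l)], for which the equation has no solution
    locally: a sieve follows the residue classes of [(n, m)] that satisfy the
    equation modulo more and more integers, until none is left.  It cannot do
    with moduli prime to 10, because they do not exclude the solutions with
    [m = 0] and [m = 1]; modulo 32 does. *)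

Lemma nth_traject_modn (T : Type) (f : T -> T) (x : T) (N n : nat) :
  0 < N -> iter N f x = x -> nth x (traject f x N) (n %% N) = iter n f x.
Proof.
move=> N_gt0 fN; rewrite nth_traject ?ltn_mod // [in RHS](divn_eq n N) addnC.
rewrite iterD; congr (iter _ _ _).
by elim: (n %/ N) => [|q IHq] //; rewrite mulSn iterD -IHq.
Qed.

Lemma map_iota_modn (T : Type) (g : nat -> T) (N n k : nat) :
  [seq g (i %% N) | i <- iota (n %% N) k] = [seq g (i %% N) | i <- iota n k].
Proof.
rewrite -[n %% N]addn0 -[in RHS](addn0 n) !iotaDl -!map_comp.
by apply: eq_map => i /=; rewrite modnDml.
Qed.

Definition modprod (p : nat) (s : seq nat) : nat :=
  foldr (fun x y => x * y %% p) 1 s.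

Lemma modprod_map (I : eqType) (p : nat) (r : seq I) (F G : I -> nat) :
  {in r, forall i, F i = G i %[mod p]} ->
  modprod p [seq F i | i <- r] = \prod_(i <- r) G i %[mod p].
Proof.
elim: r => [|i r IHr] eqFG; first by rewrite big_nil.
rewrite big_cons /= modn_mod -modnMm IHr => [|j rj].
  by rewrite eqFG ?mem_head // modnMm.
by rewrite eqFG // mem_behead.
Qed.

Lemma dvdn_expn_count_prod (I : Type) (d : nat) (P : pred I) (r : seq I)
    (F : I -> nat) :
  (forall i, P i -> d %| F i) -> d ^ count P r %| \prod_(i <- r) F i.
Proof.
move=> dvF; elim: r => [|i r IHr]; first by rewrite big_nil.
rewrite big_cons expnD dvdn_mul //.
by case: (boolP (P i)) => [/dvF|_]; rewrite ?dvd1n.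
Qed.

Definition residue_lifts (A A' a : nat) : seq nat :=
  [seq a + A * i | i <- iota 0 (A' %/ A)].

Lemma mem_residue_lifts (A A' n : nat) :
  0 < A' -> A %| A' -> n %% A' \in residue_lifts A A' (n %% A).
Proof.
move=> A'_gt0 dvA; apply/mapP; exists ((n %% A') %/ A).
  by rewrite mem_iota ltn_divRL // (leq_ltn_trans (leq_divM _ _)) // ltn_mod.
by rewrite -(modn_dvdm n dvA) [LHS](divn_eq _ A) addnC mulnC.
Qed.

Section ResidueSieve.

Variables (X C : eqType) (n_period m_period : C -> nat).
Variable passes : C -> X -> nat -> nat -> bool.

Definition meets (x : X) (n m : nat) (c : C) : Prop :=
  [/\ 0 < n_period c, 0 < m_period c
    & passes c x (n %% n_period c) (m %% m_period c)].

(* [(A, B, s)] is a list [s] of parameters [x] with a class modulo [A] and a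
   class modulo [B]. *)
Definition classes : Type := (nat * nat * seq (X * nat * nat))%type.

Definition in_classes (x : X) (n m : nat) (S : classes) : Prop :=
  let: (A, B, s) := S in [/\ 0 < A, 0 < B & (x, n %% A, m %% B) \in s].

Definition refine (S : classes) (c : C) : classes :=
  let: (A, B, s) := S in
  let pass := passes c in
  let A' := lcmn A (n_period c) in
  let B' := lcmn B (m_period c) in
  (A', B', flatten [seq
    let: (x, a, b) := xab in
    [seq (x, a', b') | a' <- residue_lifts A A' a,
       b' <- let pass_a' := pass x (a' %% n_period c) in
             [seq b' <- residue_lifts B B' b | pass_a' (b' %% m_period c)]]
  | xab <- s]).

Lemma in_refine (x : X) (n m : nat) (S : classes) (c : C) :
  meets x n m c -> in_classes x n m S -> in_classes x n m (refine S c).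
Proof.
case: S => [[A B] s] [N_gt0 o_gt0 pass_nm] [A_gt0 B_gt0 s_nm].
have [A'_gt0 B'_gt0] : 0 < lcmn A (n_period c) /\ 0 < lcmn B (m_period c).
  by rewrite !lcmn_gt0 A_gt0 B_gt0.
split=> //; apply/flatten_mapP; exists (x, n %% A, m %% B) => //.
apply/allpairsPdep.
exists (n %% lcmn A (n_period c)), (m %% lcmn B (m_period c)); split=> //.
  by rewrite mem_residue_lifts ?dvdn_lcml.
rewrite mem_filter !modn_dvdm ?dvdn_lcmr // pass_nm.
by rewrite mem_residue_lifts ?dvdn_lcml.
Qed.

Lemma in_foldl_refine (x : X) (n m : nat) (S : classes) (cs : seq C) :
  {in cs, forall c, meets x n m c} ->
  in_classes x n m S -> in_classes x n m (foldl refine S cs).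
Proof.
elim: cs S => //= c cs IHcs S meets_cs S_nm; apply: IHcs => [c' cs_c'|].
  by apply: meets_cs; rewrite mem_behead.
by apply: in_refine => //; apply/meets_cs/mem_head.
Qed.

End ResidueSieve.

Lemma tribonacciSSS (n : nat) :
  tribonacci n.+3 = tribonacci n.+2 + tribonacci n.+1 + tribonacci n.
Proof. by []. Qed.

Lemma tribonacci_gt0 (n : nat) : 0 < n -> 0 < tribonacci n.
Proof.
case: n => // n _.
suff: [&& 0 < tribonacci n.+1, 0 < tribonacci n.+2 & 0 < tribonacci n.+3].
  by case/and3P.
elim: n => [|n /and3P[T1 T2 T3]] //; apply/and3P; split=> //.
by rewrite tribonacciSSS -addnA ltn_addr.
Qed.

Lemma odd_tribonacciD4 (n : nat) :
  odd (tribonacci (n + 4)) = odd (tribonacci n).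
Proof. by rewrite addn4 !tribonacciSSS; lia. Qed.

Lemma count_odd_tribonacci4 (n : nat) :
  count (fun i => odd (tribonacci i)) (iota n 4) = 2.
Proof.
elim: n => // n; have := odd_tribonacciD4 n; rewrite addn4.
by move: (tribonacci) => T /=; lia.
Qed.

Definition trib_step (p : nat) (s : nat * nat * nat) : nat * nat * nat :=
  let: (x, y, z) := s in (y, z, (x + y + z) %% p).

Lemma iter_trib_step (p n : nat) : 1 < p ->
  iter n (trib_step p) (0, 1, 1) =
  (tribonacci n %% p, tribonacci n.+1 %% p, tribonacci n.+2 %% p).
Proof.
move=> p_gt1; elim: n => [|n IHn]; first by rewrite /= mod0n modn_small.
rewrite iterS IHn /trib_step; congr (_, _, _).
rewrite modnDmr -addnA modnDml addnCA modnDml tribonacciSSS.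
by congr (_ %% _); lia.
Qed.

Definition trib_table (p N : nat) : seq nat :=
  [seq s.1.1 | s <- traject (trib_step p) (0, 1, 1) N].

Definition is_trib_period (p N : nat) : bool :=
  [&& 1 < p, 0 < N & iter N (trib_step p) (0, 1, 1) == (0, 1, 1)].

Lemma nth_trib_table (p N n : nat) : is_trib_period p N ->
  nth 0 (trib_table p N) (n %% N) = tribonacci n %% p.
Proof.
case/and3P=> p_gt1 N_gt0 /eqP trN.
rewrite (nth_map (0, 1, 1)) ?size_traject ?ltn_mod //.
by rewrite nth_traject_modn // iter_trib_step.
Qed.

Definition trib_product (n k l : nat) : nat :=
  \prod_(n <= i < n + k) (tribonacci i).-1 *
    \prod_(n + k <= i < n + k + l) (tribonacci i).+1.

Definition trib_product_mod (p N : nat) (t : seq nat) (a k l : nat) : nat :=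
  modprod p [seq (nth 0 t (i %% N) + p.-1) %% p | i <- iota a k] *
    modprod p [seq (nth 0 t (i %% N)).+1 | i <- iota (a + k) l] %% p.

Lemma trib_product_modE (p N n k l : nat) : 0 < n -> is_trib_period p N ->
  trib_product_mod p N (trib_table p N) (n %% N) k l = trib_product n k l %% p.
Proof.
move=> n_gt0 perN; have [p_gt1 _ _] := and3P perN.
rewrite /trib_product_mod (map_iota_modn (fun j => (nth 0 _ j + p.-1) %% p)).
rewrite -(map_iota_modn (fun j => (nth 0 _ j).+1)) modnDml.
rewrite (map_iota_modn (fun j => (nth 0 _ j).+1)).
rewrite -modnMm /trib_product /index_iota !addKn -[RHS]modnMm.
congr (_ * _ %% _); apply: modprod_map => i; rewrite mem_iota nth_trib_table //.
  case/andP=> le_ni _; rewrite modn_mod modnDml.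
  rewrite -[in LHS](prednK (tribonacci_gt0 (leq_trans n_gt0 le_ni))).
  by rewrite addSnnS prednK 1?ltnW // modnDr.
by move=> _; rewrite -addn1 modnDml addn1.
Qed.

Lemma dvdn16_trib_product (n k l : nat) :
  8 <= k + l -> 16 %| trib_product n k l.
Proof.
move=> kl_ge8; pose T_odd i := odd (tribonacci i).
suff: 2 ^ count T_odd (iota n (k + l)) %| trib_product n k l.
  apply/dvdn_trans/(@dvdn_exp2l 2 4).
  rewrite -(subnKC kl_ge8) iotaD -[8]/(4 + 4) iotaD !count_cat.
  by rewrite !count_odd_tribonacci4 leq_addr.
rewrite iotaD count_cat expnD /trib_product /index_iota !addKn.
by apply: dvdn_mul; apply: dvdn_expn_count_prod => i; rewrite /T_odd; lia.
Qed.

Definition repunit (m : nat) : nat := \sum_(i < m) 10 ^ i.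

Lemma repunitS (m : nat) : repunit m.+1 = 10 * repunit m + 1.
Proof.
rewrite /repunit big_ord_recl addnC big_distrr /=; congr (_ + _).
by apply: eq_bigr => i _; rewrite expnS.
Qed.

Lemma repdigit_ndvdn16 (d m : nat) :
  0 < m -> 0 < d < 16 -> ~~ (16 %| d * repunit m).
Proof.
case: m => // m _ /andP[d_gt0 d_lt16].
have co16 : coprime (2 ^ 4) (repunit m.+1).
  by rewrite coprimeXl // coprime2n repunitS; lia.
by rewrite Gauss_dvdl // gtnNdvd.
Qed.

(* The entries of [u] are lists of residues, because the repunits need not be
   periodic modulo [p] from the start. *)
Definition is_repunit_table (p : nat) (u : seq (seq nat)) : bool :=
  (11 %% p \in nth [::] u (2 %% size u)) &&
  all (fun b => all (fun r => (10 * r + 1) %% p \in nth [::] u (b.+1 %% size u))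
                    (nth [::] u b))
      (iota 0 (size u)).

Lemma mem_repunit_table (p m : nat) (u : seq (seq nat)) :
  is_repunit_table p u -> 1 < m -> repunit m %% p \in nth [::] u (m %% size u).
Proof.
case/andP=> u_2 /allP u_step; case: m => [|[|m]] // _.
elim: m => [|m IHm]; first by rewrite !repunitS /repunit big_ord0.
have u_gt0 : 0 < size u by case: (u) u_2.
have u_m : m.+2 %% size u \in iota 0 (size u) by rewrite mem_iota ltn_mod.
have := allP (u_step _ u_m) _ IHm.
rewrite -[(10 * _ + 1) %% p]modnDml modnMmr modnDml -repunitS.
by rewrite -[(_ %% _).+1]addn1 modnDml addn1.
Qed.

(* [(p, N, u)]: a modulus [p], a period [N] of the Tribonacci numbers modulo
   [p], and a table [u] of the repunits modulo [p]. *)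
Definition modulus : Type := (nat * nat * seq (seq nat))%type.

Definition trib_period (c : modulus) : nat := c.1.2.

Definition repunit_period (c : modulus) : nat := size c.2.

Definition valid_modulus (c : modulus) : bool :=
  let: (p, N, u) := c in is_trib_period p N && is_repunit_table p u.

(* The abstractions are staged so that evaluation computes the Tribonacci table
   once per modulus and the product once per class of [n]. *)
Definition repdigit_congruence (c : modulus) :
    nat * nat * nat -> nat -> nat -> bool :=
  let: (p, N, u) := c in
  let t := trib_table p N in
  fun kld a => let: (k, l, d) := kld in
    let v := trib_product_mod p N t a k l in
    fun b => v \in [seq d * r %% p | r <- nth [::] u b].

Lemma meets_repdigit_congruence (c : modulus) (n k l m d : nat) :
  valid_modulus c -> 0 < n -> 1 < m -> trib_product n k l = d * repunit m ->
  meets trib_period repunit_period repdigit_congruence (k, l, d) n m c.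
Proof.
case: c => [[p N] u] /andP[perN tab_u] n_gt0 m_gt1 eq_nm.
have u_m := mem_repunit_table tab_u m_gt1.
rewrite /meets /trib_period /repunit_period /=.
split; [by case/and3P: perN | by case: (u) u_m; rewrite ?nth_nil |].
by rewrite trib_product_modE // eq_nm -modnMmr; apply: map_f.
Qed.

Definition singleton_table (p o : nat) : seq (seq nat) :=
  [seq [:: r] | r <- traject (fun r => (10 * r + 1) %% p) 0 o].

(* The repunits with at least two digits are 11, 15, 23, 7, 7, 7, ... modulo 32.
   The other moduli are such that their periods share large factors with the
   previous ones, whence few lifts. *)
Definition moduli : seq modulus :=
  (32, 64, [:: [:: 11; 15; 23; 7]]) ::
  [seq (pNo.1.1, pNo.1.2, singleton_table pNo.1.1 pNo.2) | pNo <-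
    [:: (7, 48, 6); (17, 96, 16); (257, 256, 256); (13, 168, 6);
        (127, 5376, 42); (421, 420, 140)]].

Lemma valid_moduli : all valid_modulus moduli.
Proof. by vm_compute. Qed.

Definition all_classes : classes (nat * nat * nat)%type :=
  (1, 1, [seq (kl, d, 0, 0) |
    kl <- [seq (k, l) | k <- iota 1 6, l <- iota 1 (7 - k)], d <- iota 1 9]).

Definition surviving_classes : classes (nat * nat * nat)%type :=
  foldl (refine trib_period repunit_period repdigit_congruence)
        all_classes moduli.

Lemma surviving_classes_nil : surviving_classes.2 = [::].
Proof. by vm_compute. Qed.

Lemma in_surviving_classes (n k l m d : nat) :
    0 < n -> 0 < k -> 0 < l -> k + l < 8 -> 1 < m -> 0 < d < 10 ->
  trib_product n k l = d * repunit m ->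
  in_classes (k, l, d) n m surviving_classes.
Proof.
move=> n_gt0 k_gt0 l_gt0 kl_lt8 m_gt1 d_lt10 eq_nm; apply: in_foldl_refine.
  by move=> c /(allP valid_moduli)/meets_repdigit_congruence; apply.
split=> //; rewrite !modn1; apply/allpairsP; exists ((k, l), d).
split=> //; last by rewrite mem_iota.
by apply/allpairsPdep; exists k, l; rewrite !mem_iota; split=> //=; lia.
Qed.

Lemma trib_product_neq_repdigit (n k l m d : nat) :
  0 < n -> 0 < k -> 0 < l -> 1 < m -> 0 < d < 10 ->
  trib_product n k l <> d * repunit m.
Proof.
move=> n_gt0 k_gt0 l_gt0 m_gt1 d_lt10 eq_nm.
have [kl_lt8|kl_ge8] := ltnP (k + l) 8.
  have := in_surviving_classes n_gt0 k_gt0 l_gt0 kl_lt8 m_gt1 d_lt10 eq_nm.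
  by case: surviving_classes surviving_classes_nil => [[A B] s] /= -> [].
have /negP[] : ~~ (16 %| d * repunit m) by apply: repdigit_ndvdn16; lia.
by rewrite -eq_nm dvdn16_trib_product.
Qed.

Import GRing.Theory Num.Theory.

Local Open Scope ring_scope.

Lemma natr_trib_product (R : pzRingType) (n k l : nat) : (0 < n)%N ->
  (trib_product n k l)%:R =
  (\prod_(n <= i < n + k) ((tribonacci i)%:R - 1)) *
    (\prod_(n + k <= i < n + k + l) ((tribonacci i)%:R + 1)) :> R.
Proof.
move=> n_gt0; rewrite natrM !natr_prod; congr (_ * _).
  apply: eq_big_nat => i /andP[le_ni _].
  by rewrite -subn1 natrB // tribonacci_gt0 // (leq_trans n_gt0).
by apply: eq_bigr => i _; rewrite -natr1.
Qed.

Lemma natr_repunit (F : numFieldType) (m : nat) :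
  (repunit m)%:R = (10 ^+ m - 1) / 9 :> F.
Proof.
have -> : 10 ^+ m - 1 = 9 * (repunit m)%:R :> F.
  rewrite subrX1 natr_sum -[X in X - 1]natr1 addrK; congr (_ * _).
  by apply: eq_bigr => i _; rewrite natrX.
by rewrite mulrC mulKf // pnatr_eq0.
Qed.

Theorem theorem3 (n k l m d : nat) :
  (0 < n)%N -> (0 < k)%N -> (0 < l)%N -> (2 <= m)%N -> (1 <= d <= 9)%N ->
  (\prod_(n <= i < n + k) ((tribonacci i)%:R - 1)) *
    (\prod_(n + k <= i < n + k + l) ((tribonacci i)%:R + 1))
  <> d%:R * ((10 ^+ m - 1) / 9) :> rat.
Proof.
move=> n_gt0 k_gt0 l_gt0 m_ge2 d19.
rewrite -natr_trib_product // -natr_repunit -natrM.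
move=> /eqP; rewrite eqr_nat => /eqP.
exact: trib_product_neq_repdigit.
Qed.
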